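(* Let $G$ be an infinite directed graph formed by a countable union of vertex-disjoint oriented cycles. Then the hike poset $P_G$ is isomorphic to the poset $P_{\mathbb N}$ of natural integers ordered by divisibility. In particular, the reduced incidence algebra $(\mathcal F,* )$ of $P_G$ is isomorphic to the algebra of Dirichlet series equipped with ordinary multiplication.
   Context: Here natural integers are the positive integers, and oriented cycles are finite directed cycles (so $G$ has countably infinitely many of them as components). For a directed graph $G$ with vertices $v_i$, each arc $(v_i,v_j)$ is identified with a letter $w_{ij}$. Let $\mathcal M$ be the trace monoid generated by the arcs, i.e. the quotient of the free monoid (finite words) on the arcs by the relations $w_{ij}w_{kl}=w_{kl}w_{ij}$ for $i\neq k$. A hike is an element $h=w_{i_1j_1}\cdots w_{i_\ell j_\ell}$ of $\mathcal M$ such that for each vertex index $i$, $\#\{k: i_k=i\}=\#\{k: j_k=i\}$. The hikes form a submonoid $\mathcal H$ of $\mathcal M$, containing the empty hike $1$. For $d,h\in\mathcal H$, $d\mid h$ means $h=d.h'$ for some (necessarily unique) $h'\in\mathcal H$, denoted $h/d$. $P_G$ is the set $\mathcal H$ partially ordered by left division $\mid$. The reduced incidence algebra $(\mathcal F,* )$ is the set $\mathcal F$ of real-valued functions on $\mathcal H$ with the Dirichlet convolution $f*g(h)=\sum_{d\mid h}f(d)g(h/d)$. The algebra of Dirichlet series is the algebra of formal series $\sum_{n\ge1}a_n n^{-s}$, $a_n\in\mathbb R$, with the usual multiplication. *)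

(* Defs.v *)
From HB Require Import structures.
From mathcomp Require Import all_boot all_order all_algebra.
From mathcomp Require Import all_classical reals.

Set Implicit Arguments.
Unset Strict Implicit.
Unset Printing Implicit Defensive.

Import Order.TTheory GRing.Theory.

Local Open Scope quotient_scope.

(* At most one arc in each direction between two vertices; self-loops allowed. *)
Record digraph := Digraph { vertex : choiceType; arc : rel vertex }.

(* The cycles are indexed by [nat], so there are infinitely many of them.
   [next s x] is the cyclic successor of [x] in [s], so that [C n] is the
   oriented cycle x_0 -> x_1 -> ... -> x_(l-1) -> x_0 for [C n] the sequence of
   its vertices. A cycle of length 1 is a self-loop. *)
Definition countable_union_of_cycles (G : digraph) : Prop :=
  exists C : nat -> seq (vertex G),
    [/\ forall n, C n != [::] /\ uniq (C n),
        forall m n x, x \in C m -> x \in C n -> m = n,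
        forall x, exists n, x \in C n
      & forall x y, arc x y <-> exists2 n, x \in C n & y = next (C n) x].

Section Trace.
Variable G : digraph.

Definition letter := {a : vertex G * vertex G | arc a.1 a.2}.
Definition source (a : letter) : vertex G := (val a).1.
Definition target (a : letter) : vertex G := (val a).2.

Definition word := seq letter.
Implicit Types (u v w : word) (a b : letter) (i : vertex G).

Inductive trace_cong : word -> word -> Prop :=
| trace_swap a b : source a != source b -> trace_cong [:: a; b] [:: b; a]
| trace_cat u u' v v' :
    trace_cong u u' -> trace_cong v v' -> trace_cong (u ++ v) (u' ++ v')
| trace_refl u : trace_cong u u
| trace_sym u v : trace_cong u v -> trace_cong v u
| trace_trans v u w : trace_cong u v -> trace_cong v w -> trace_cong u w.

Definition trace_rel : rel word := fun u v => `[< trace_cong u v >].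

Lemma trace_rel_refl : reflexive trace_rel.
Proof. by move=> u; apply/asboolP; exact: trace_refl. Qed.

Lemma trace_rel_sym : symmetric trace_rel.
Proof. by move=> u v; apply/asboolP/asboolP; exact: trace_sym. Qed.

Lemma trace_rel_trans : transitive trace_rel.
Proof.
by move=> v u w /asboolP uv /asboolP vw; apply/asboolP; exact: trace_trans uv vw.
Qed.

Canonical trace_equiv :=
  EquivRel trace_rel trace_rel_refl trace_rel_sym trace_rel_trans.

Definition trace := {eq_quot trace_equiv}.
HB.instance Definition _ := Choice.on trace.
HB.instance Definition _ := EqQuotient.on trace.

Definition trace_of (w : word) : trace := \pi_trace w.

Lemma trace_ofP u v : trace_of u = trace_of v <-> trace_cong u v.
Proof.
by split=> [/(@eqmodP _ trace_equiv)/asboolP|/asboolP/(@eqmodP _ trace_equiv)].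
Qed.

Lemma trace_of_repr (t : trace) : trace_of (repr t) = t.
Proof. exact: reprK. Qed.

Definition trace_mul (s t : trace) : trace := trace_of (repr s ++ repr t).

Lemma trace_mulE u v : trace_mul (trace_of u) (trace_of v) = trace_of (u ++ v).
Proof. by apply/trace_ofP/trace_cat; apply/trace_ofP; rewrite trace_of_repr. Qed.

Lemma trace_mulA : associative trace_mul.
Proof.
move=> r s t; rewrite -(trace_of_repr r) -(trace_of_repr s) -(trace_of_repr t).
by rewrite !trace_mulE catA.
Qed.

Lemma trace_mul1t : left_id (trace_of [::]) trace_mul.
Proof. by move=> t; rewrite -(trace_of_repr t) trace_mulE. Qed.

Lemma trace_mult1 : right_id (trace_of [::]) trace_mul.
Proof. by move=> t; rewrite -(trace_of_repr t) trace_mulE cats0. Qed.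

HB.instance Definition _ :=
  isMonoid.Build trace trace_mulA trace_mul1t trace_mult1.

Lemma trace_ofM u v : (trace_of u * trace_of v)%g = trace_of (u ++ v).
Proof. exact: trace_mulE. Qed.

Lemma trace_of1 : trace_of [::] = 1%g.
Proof. by []. Qed.

Lemma trace_cong_perm u v : trace_cong u v -> perm_eq u v.
Proof.
elim=> {u v} [a b _|u u' v v' _ uu' _ vv'|u|u v _|v u w _ uv _ vw] //.
- by apply/permP => p /=; rewrite !addn0 addnC.
- exact: perm_cat.
- by rewrite perm_sym.
- exact: perm_trans uv vw.
Qed.

Definition from i w : word := [seq a <- w | source a == i].

(* Dependence ([source a = source b]) is an equivalence relation on the letters,
   so a trace is determined by its projections on the classes. *)
Lemma trace_congP u v : trace_cong u v <-> forall i, from i u = from i v.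
Proof.
split.
  elim=> {u v} [a b ab i|u u' v v' _ uu' _ vv' i|u|u v _ uv i|v u w _ uv _ vw i] //.
  - rewrite /from /=; case: eqP => [<-|//]; rewrite eq_sym in ab.
    by rewrite (negbTE ab).
  - by rewrite /from !filter_cat -!/(from i _) uu' vv'.
  - by rewrite uv vw.
elim: u v => [|a u IHu] v uv.
  case: v uv => [|b v] uv; first exact: trace_refl.
  by have := uv (source b); rewrite /from /= eqxx.
have [v1 [v2 [ve v1a]]] : exists v1 v2, v = v1 ++ a :: v2 /\
    from (source a) v1 = [::].
  have := uv (source a); rewrite /from /= eqxx.
  elim: v {uv} => [//|b v IHv] /=; case: eqP => [_ [<- _]|ba e].
    by exists [::], v.
  have [v1 [v2 [-> v1a]]] := IHv e; exists (b :: v1), v2.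
  by rewrite /= v1a; case: eqP ba.
subst v; have comm : trace_cong (v1 ++ a :: v2) (a :: v1 ++ v2).
  elim: v1 v1a {uv} => [_|b v1 IHv]; first exact: trace_refl.
  rewrite /from /=; case: eqP => // /eqP ba v1a.
  apply: (@trace_trans ([:: b] ++ (a :: v1 ++ v2))).
    by apply: (@trace_cat [:: b] [:: b]) => //; [exact: trace_refl|exact: IHv].
  apply: (@trace_cat [:: b; a] [:: a; b]); last exact: trace_refl.
  exact: trace_swap.
apply/trace_sym/(trace_trans comm)/trace_sym/(@trace_cat [:: a] [:: a]).
  exact: trace_refl.
apply: IHu => i; have := uv i; rewrite /from /= !filter_cat /=.
case: eqP => [<-|_] //; rewrite -!/(from _ _) v1a /=.
by move=> -[->].
Qed.

Lemma trace_mulgI (d : trace) : injective (fun t : trace => (d * t)%g).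
Proof.
move=> s t /=; rewrite -(trace_of_repr d) -(trace_of_repr s) -(trace_of_repr t).
rewrite !trace_ofM => /trace_ofP/trace_congP dst.
apply/trace_ofP/trace_congP => i; have := dst i.
rewrite /from !filter_cat => /(congr1 (drop (size (from i (repr d))))).
by rewrite !drop_size_cat.
Qed.

Lemma trace_mul_eq1 (s t : trace) : (s * t)%g = 1%g -> s = 1%g /\ t = 1%g.
Proof.
rewrite -(trace_of_repr s) -(trace_of_repr t) trace_ofM -trace_of1.
move=> /trace_ofP/trace_cong_perm/perm_nilP.
by case: (repr s) => //; case: (repr t).
Qed.

Lemma trace_finite_fact (t : trace) :
  finite_set [set p : trace * trace | (p.1 * p.2)%g = t].
Proof.
set w := repr t.
pose s : seq (trace * trace) :=
  [seq (trace_of (take k u), trace_of (drop k u))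
     | u <- permutations w, k <- iota 0 (size w).+1].
apply: (@sub_finite_set _ _ [set` s]); last exact: finite_seq.
move=> [x y] /=; rewrite -{1}(trace_of_repr x) -{1}(trace_of_repr y) trace_ofM.
rewrite -[in X in X -> _](trace_of_repr t) => /trace_ofP/trace_cong_perm xyw.
apply/allpairsP; exists (repr x ++ repr y, size (repr x)) => /=; split.
- by rewrite mem_permutations.
- rewrite -/(iota 0 (size w).+1) mem_iota ltnS -/w -(perm_size xyw) size_cat.
  by rewrite leq0n leq_addr.
- by rewrite take_size_cat // drop_size_cat // !trace_of_repr.
Qed.

Definition balanced w : Prop :=
  forall i, count (fun a => source a == i) w = count (fun a => target a == i) w.

Definition is_hike : {pred trace} :=
  fun t => `[< exists2 w, t = trace_of w & balanced w >].

Lemma is_hike_trace_of w : is_hike (trace_of w) <-> balanced w.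
Proof.
split=> [/asboolP[v /trace_ofP/trace_cong_perm/permP wv bv] i|bw].
  by rewrite !wv.
by apply/asboolP; exists w.
Qed.

Lemma is_hike_monoid : monoid_closed is_hike.
Proof.
split; first by apply/is_hike_trace_of.
move=> _ _ /asboolP[u -> bu] /asboolP[v -> bv]; rewrite trace_ofM.
by apply/is_hike_trace_of => i; rewrite !count_cat bu bv.
Qed.

Record hike := Hike { hike_val : trace; _ : hike_val \in is_hike }.

HB.instance Definition _ := [isSub for hike_val].
HB.instance Definition _ := [Choice of hike by <:].
HB.instance Definition _ :=
  SubChoice_isSubMonoid.Build trace is_hike hike is_hike_monoid.

Implicit Types (d f g h : hike).

Definition hike_dvd d h : Prop := exists h', h = (d * h')%g.

Lemma hike_valM d h : val (d * h)%g = (val d * val h)%g.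
Proof. exact: gmulfM. Qed.

Lemma hike_val1 : val (1%g : hike) = 1%g.
Proof. exact: gmulf1. Qed.

Lemma hike_mulgI d : injective (fun h => (d * h)%g).
Proof.
by move=> h h' /(congr1 val); rewrite !hike_valM => /trace_mulgI/val_inj.
Qed.

Lemma hike_mul_eq1 d h : (d * h)%g = 1%g -> d = 1%g.
Proof.
move=> /(congr1 val); rewrite hike_valM hike_val1 => /trace_mul_eq1[d1 _].
by apply/val_inj; rewrite hike_val1.
Qed.

Lemma hike_finite_fact h : finite_set [set p : hike * hike | (p.1 * p.2)%g = h].
Proof.
pose F (p : hike * hike) : trace * trace := (val p.1, val p.2).
apply: (@sub_finite_set _ _
  (F @^-1` [set p : trace * trace | (p.1 * p.2)%g = val h])).
  by move=> [x y] /= <-; rewrite hike_valM.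
apply: finite_preimage; last exact: trace_finite_fact.
by move=> [x y] [x' y'] _ _ [/val_inj-> /val_inj->].
Qed.

Definition hike_le : rel hike := fun d h => `[< hike_dvd d h >].

Lemma hike_le_refl : reflexive hike_le.
Proof. by move=> h; apply/asboolP; exists 1%g; rewrite mulg1. Qed.

Lemma hike_le_anti : antisymmetric hike_le.
Proof.
move=> d h /andP[/asboolP[x ->] /asboolP[y]].
rewrite -mulgA -{1}(mulg1 d) => /hike_mulgI/esym/hike_mul_eq1 ->.
by rewrite mulg1.
Qed.

Lemma hike_le_trans : transitive hike_le.
Proof.
move=> y x z /asboolP[u ->] /asboolP[v ->].
by apply/asboolP; exists (u * v)%g; rewrite mulgA.
Qed.

HB.instance Definition _ := Order.Le_isPOrder.Build Order.dvd_display hike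
  hike_le_refl hike_le_anti hike_le_trans.

(* [hike_div h d] is the h' such that h = d.h', see [hike_mulKg]; the value is
   1 when d does not divide h. *)
Definition hike_div h d : hike := xget 1%g [set h' | h = (d * h')%g].

Lemma hike_mulKg d h : hike_div (d * h)%g d = h.
Proof. by apply: xget_unique => //= h' /hike_mulgI. Qed.

End Trace.

Record posnat := PosNat { posnat_val :> nat; _ : (0 < posnat_val)%N }.

HB.instance Definition _ := [isSub for posnat_val].
HB.instance Definition _ := [Countable of posnat by <:].

Lemma posnat_gt0 (n : posnat) : (0 < n)%N. Proof. exact: valP. Qed.

Lemma posnat_mul_gt0 (m n : posnat) : (0 < m * n)%N.
Proof. by rewrite muln_gt0 !posnat_gt0. Qed.

Definition posnat_one : posnat := PosNat (ltn0Sn 0).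
Definition posnat_mul (m n : posnat) : posnat := PosNat (posnat_mul_gt0 m n).

Lemma posnat_mulA : associative posnat_mul.
Proof. by move=> m n p; apply: val_inj; exact: mulnA. Qed.

Lemma posnat_mul1n : left_id posnat_one posnat_mul.
Proof. by move=> n; apply: val_inj; exact: mul1n. Qed.

Lemma posnat_muln1 : right_id posnat_one posnat_mul.
Proof. by move=> n; apply: val_inj; exact: muln1. Qed.

HB.instance Definition _ :=
  isMonoid.Build posnat posnat_mulA posnat_mul1n posnat_muln1.

Definition posnat_dvd : rel posnat := fun m n => (m %| n)%N.

Lemma posnat_dvd_refl : reflexive posnat_dvd.
Proof. by move=> n; exact: dvdnn. Qed.

Lemma posnat_dvd_anti : antisymmetric posnat_dvd.
Proof. by move=> m n mn; apply/val_inj/eqP; rewrite eqn_dvd. Qed.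

Lemma posnat_dvd_trans : transitive posnat_dvd.
Proof. by move=> n m p; exact: dvdn_trans. Qed.

HB.instance Definition _ := Order.Le_isPOrder.Build Order.dvd_display posnat
  posnat_dvd_refl posnat_dvd_anti posnat_dvd_trans.

Lemma posnat_finite_fact (k : posnat) :
  finite_set [set p : posnat * posnat | (p.1 * p.2)%g = k].
Proof.
pose F (p : posnat * posnat) : nat * nat := (val p.1, val p.2).
pose s : seq (nat * nat) := [seq (m, n) | m <- iota 0 k.+1, n <- iota 0 k.+1].
apply: (@sub_finite_set _ _ (F @^-1` [set` s])).
  move=> [x y] xyk; apply/allpairsP; exists (val x, val y).
  rewrite !mem_iota !leq0n !add0n !ltnS -xyk; split=> //.
    by rewrite leq_pmulr // posnat_gt0.
  by rewrite leq_pmull // posnat_gt0.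
apply: finite_preimage; last exact: finite_seq.
by move=> [x y] [x' y'] _ _ [/val_inj-> /val_inj->].
Qed.

Section Convolution.
Local Open Scope ring_scope.
Variables (R : comNzRingType) (M : monoidType).
Hypothesis finM : forall x : M, finite_set [set p : M * M | (p.1 * p.2)%g = x].
Implicit Types (f g k : M -> R) (x : M).

Definition conv f g : M -> R :=
  fun x => \sum_(p \in [set p : M * M | (p.1 * p.2)%g = x]) f p.1 * g p.2.

Definition conv1 : M -> R := fun x => (x == 1%g)%:R.

Let facts x : seq (M * M) :=
  finmap.enum_fset (fset_set [set p : M * M | (p.1 * p.2)%g = x]).
Let factors x : seq M :=
  undup ([seq p.1 | p <- facts x] ++ [seq p.2 | p <- facts x]).

Let mem_facts x p : (p \in facts x) = ((p.1 * p.2)%g == x).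
Proof. by rewrite in_fset_set //; apply/idP/eqP; rewrite inE. Qed.

Let factorsl a b x : (a * b)%g = x -> a \in factors x.
Proof.
move=> e; rewrite mem_undup mem_cat; apply/orP; left; apply/mapP; exists (a, b) => //.
by rewrite mem_facts e.
Qed.

Let factorsr a b x : (a * b)%g = x -> b \in factors x.
Proof.
move=> e; rewrite mem_undup mem_cat; apply/orP; right; apply/mapP; exists (a, b) => //.
by rewrite mem_facts e.
Qed.

Let convE s f g x : uniq s -> {subset factors x <= s} ->
  conv f g x =
  \sum_(a <- s) \sum_(b <- s) ((a * b)%g == x)%:R * (f a * g b).
Proof.
move=> us sub; rewrite /conv fsbig_finite //=.
transitivity (\sum_(p <- facts x) ((p.1 * p.2)%g == x)%:R * (f p.1 * g p.2)).
  by apply: eq_big_seq => p; rewrite mem_facts => ->; rewrite mul1r.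
transitivity (\sum_(p <- [seq (a, b) | a <- s, b <- s])
    ((p.1 * p.2)%g == x)%:R * (f p.1 * g p.2)); last by rewrite big_allpairs.
rewrite [RHS](bigID (fun p => (p.1 * p.2)%g == x)) /= [X in _ + X]big1 ?addr0.
  rewrite -[RHS]big_filter; apply: perm_big; apply: uniq_perm.
  - exact: finmap.fset_uniq.
  - by rewrite filter_uniq // allpairs_uniq // => -[? ?] [? ?].
  move=> [a b]; rewrite mem_facts mem_filter /=.
  case: eqP => //= abx; apply/esym/allpairsP; exists (a, b); split=> //=.
    by apply: sub; exact: factorsl abx.
  by apply: sub; exact: factorsr abx.
by move=> p /negbTE ->; rewrite mul0r.
Qed.

Let sum_delta s (P : pred M) d0 (c : R) : uniq s -> (P d0 -> d0 \in s) ->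
  \sum_(d <- s) (P d)%:R * ((d0 == d)%:R * c) = (P d0)%:R * c.
Proof.
move=> us d0s; case: (boolP (d0 \in s)) => [d0in|d0out].
  rewrite (bigD1_seq d0) //= eqxx mul1r big1 ?addr0 // => d /negbTE.
  by rewrite eq_sym => ->; rewrite mul0r mulr0.
have /negbTE -> : ~~ P d0 by apply: contra d0out.
rewrite mul0r big_seq big1 // => d ds; case: eqP => [d0d|]; last first.
  by rewrite mul0r mulr0.
by rewrite d0d ds in d0out.
Qed.

Lemma convA : associative conv.
Proof.
move=> f g k; apply/funext => x.
pose s := undup (factors x ++ flatten [seq factors y | y <- factors x]).
have us : uniq s by exact: undup_uniq.
have sx : {subset factors x <= s}.
  by move=> a ax; rewrite mem_undup mem_cat ax.
have sxy y : y \in factors x -> {subset factors y <= s}.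
  move=> yx a ay; rewrite mem_undup mem_cat; apply/orP; right.
  by apply/flatten_mapP; exists y.
pose T a b c := ((a * b * c)%g == x)%:R * (f a * g b * k c).
transitivity (\sum_(a <- s) \sum_(b <- s) \sum_(c <- s) T a b c).
  rewrite (convE _ _ us sx); apply: eq_bigr => a _.
  transitivity (\sum_(d <- s) \sum_(b <- s) \sum_(c <- s)
      ((a * d)%g == x)%:R * (((b * c)%g == d)%:R * (f a * g b * k c))).
    apply: eq_bigr => d _; case: eqP => [adx|_]; last first.
      by rewrite mul0r big1 // => b _; rewrite big1 // => c _; rewrite mul0r.
    rewrite mul1r (convE _ _ us (sxy _ (factorsr adx))) mulr_sumr.
    apply: eq_bigr => b _; rewrite mulr_sumr; apply: eq_bigr => c _.
    by rewrite mul1r mulrCA !mulrA.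
  rewrite exchange_big; apply: eq_bigr => b _.
  rewrite exchange_big; apply: eq_bigr => c _.
  rewrite (sum_delta (P := fun d => (a * d)%g == x)) //.
    by rewrite /T mulgA.
  by move=> /eqP/factorsr/sx.
rewrite (convE _ _ us sx) [RHS]exchange_big /=.
under [RHS]eq_bigr => c _.
  rewrite (_ : \sum_(d <- s) _ = \sum_(a <- s) \sum_(b <- s) T a b c).
    over.
  transitivity (\sum_(d <- s) \sum_(a <- s) \sum_(b <- s)
      ((d * c)%g == x)%:R * (((a * b)%g == d)%:R * (f a * g b * k c))).
    apply: eq_bigr => d _; case: eqP => [dcx|_]; last first.
      by rewrite mul0r big1 // => a _; rewrite big1 // => b _; rewrite mul0r.
    rewrite mul1r (convE _ _ us (sxy _ (factorsl dcx))) mulr_suml.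
    apply: eq_bigr => a _; rewrite mulr_suml; apply: eq_bigr => b _.
    by rewrite mul1r !mulrA.
  rewrite exchange_big; apply: eq_bigr => a _.
  rewrite exchange_big; apply: eq_bigr => b _.
  rewrite (sum_delta (P := fun d => (d * c)%g == x)) //.
  by move=> /eqP/factorsl/sx.
rewrite [RHS]exchange_big; apply: eq_bigr => a _.
by rewrite exchange_big.
Qed.

Lemma conv1f : left_id conv1 conv.
Proof.
move=> f; apply/funext => x.
have us : uniq (factors x) by exact: undup_uniq.
rewrite (convE _ _ us (fun _ => id)) /conv1 exchange_big /=.
have xx : x \in factors x by apply: (@factorsr 1%g); rewrite mul1g.
have x1 : 1%g \in factors x by apply: (@factorsl _ x); rewrite mul1g.
rewrite (bigD1_seq x) //= (bigD1_seq 1%g) //= mul1g !eqxx !mul1r.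
rewrite !big1 ?addr0 // => [b bx|a /negbTE ->]; last by rewrite mul0r mulr0.
rewrite big1 // => a _; case: (a =P 1%g) => [->|_].
  by rewrite mul1g (negbTE bx) mul0r.
by rewrite mul0r mulr0.
Qed.

Lemma convf1 : right_id conv1 conv.
Proof.
move=> f; apply/funext => x.
have us : uniq (factors x) by exact: undup_uniq.
rewrite (convE _ _ us (fun _ => id)) /conv1.
have xx : x \in factors x by apply: (@factorsr 1%g); rewrite mul1g.
have x1 : 1%g \in factors x by apply: (@factorsl _ x); rewrite mul1g.
rewrite (bigD1_seq x) //= (bigD1_seq 1%g) //= mulg1 !eqxx mul1r mulr1.
rewrite !big1 ?addr0 // => [a ax|b /negbTE ->]; last by rewrite !mulr0.
rewrite big1 // => b _; case: (b =P 1%g) => [->|_].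
  by rewrite mulg1 (negbTE ax) mul0r.
by rewrite !mulr0.
Qed.

Let conv_finite f g x : conv f g x = \sum_(p <- facts x) f p.1 * g p.2.
Proof. by rewrite /conv fsbig_finite. Qed.

Lemma convDl f g k x : conv (fun y => f y + g y) k x = conv f k x + conv g k x.
Proof.
by rewrite !conv_finite -big_split; apply: eq_bigr => p _; rewrite mulrDl.
Qed.

Lemma convDr f g k x : conv f (fun y => g y + k y) x = conv f g x + conv f k x.
Proof.
by rewrite !conv_finite -big_split; apply: eq_bigr => p _; rewrite mulrDr.
Qed.

Lemma convZl (c : R) f g x : conv (fun y => c * f y) g x = c * conv f g x.
Proof.
by rewrite !conv_finite mulr_sumr; apply: eq_bigr => p _; rewrite mulrA.
Qed.

Lemma convZr (c : R) f g x : conv f (fun y => c * g y) x = c * conv f g x.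
Proof.
by rewrite !conv_finite mulr_sumr; apply: eq_bigr => p _; rewrite mulrCA.
Qed.

End Convolution.

Section Incidence.
Local Open Scope ring_scope.
Variables (R : comNzRingType) (G : digraph).

Definition incidence := hike G -> R.
HB.instance Definition _ := GRing.Lmodule.copy incidence (hike G -> R^o).

Implicit Types (f g : incidence) (d h : hike G).

Definition incidence_mul f g : incidence :=
  fun h => \sum_(d \in [set d | hike_dvd d h]) f d * g (hike_div h d).

Definition incidence_one : incidence := fun h => (h == 1%g)%:R.

Lemma incidence_mulE f g : incidence_mul f g = conv f g.
Proof.
apply/funext => h; rewrite /incidence_mul /conv.
rewrite (reindex_fsbig (fun p : hike G * hike G => p.1)
  [set p : hike G * hike G | (p.1 * p.2)%g = h] [set d | hike_dvd d h]) //=.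
  by apply: eq_fsbigr => -[d h'] /=; rewrite inE => <-; rewrite hike_mulKg.
split=> [[d h'] /= <-|[d h'] [d2 h2]|d [h' ->]] /=; first by exists h'.
  by rewrite !inE /= => <- + dd; rewrite -dd => /hike_mulgI ->.
by exists (d, h').
Qed.

Lemma incidence_mulA : associative incidence_mul.
Proof.
by move=> f g k; rewrite !incidence_mulE convA //; exact: hike_finite_fact.
Qed.

Lemma incidence_mul1f : left_id incidence_one incidence_mul.
Proof.
by move=> f; rewrite incidence_mulE conv1f //; exact: hike_finite_fact.
Qed.

Lemma incidence_mulf1 : right_id incidence_one incidence_mul.
Proof.
by move=> f; rewrite incidence_mulE convf1 //; exact: hike_finite_fact.
Qed.

Lemma incidence_mulDl : left_distributive incidence_mul +%R.
Proof.
move=> f g k; rewrite !incidence_mulE; apply/funext => h.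
by apply: convDl; exact: hike_finite_fact.
Qed.

Lemma incidence_mulDr : right_distributive incidence_mul +%R.
Proof.
move=> f g k; rewrite !incidence_mulE; apply/funext => h.
by apply: convDr; exact: hike_finite_fact.
Qed.

Lemma incidence_one_neq0 : incidence_one != 0.
Proof.
apply/eqP => /(congr1 (fun f : incidence => f 1%g)) /eqP.
by rewrite /incidence_one eqxx oner_eq0.
Qed.

HB.instance Definition _ := GRing.Zmodule_isNzRing.Build incidence
  incidence_mulA incidence_mul1f incidence_mulf1
  incidence_mulDl incidence_mulDr incidence_one_neq0.

Lemma incidence_scaleAl (c : R) f g : c *: (f * g) = (c *: f) * g.
Proof.
rewrite /GRing.mul /= !incidence_mulE; apply/funext => h.
by apply/esym/convZl; exact: hike_finite_fact.
Qed.

HB.instance Definition _ :=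
  GRing.Lmodule_isLalgebra.Build R incidence incidence_scaleAl.

Lemma incidence_scaleAr (c : R) f g : c *: (f * g) = f * (c *: g).
Proof.
rewrite /GRing.mul /= !incidence_mulE; apply/funext => h.
by apply/esym/convZr; exact: hike_finite_fact.
Qed.

HB.instance Definition _ :=
  GRing.Lalgebra_isAlgebra.Build R incidence incidence_scaleAr.

End Incidence.

Section Dirichlet.
Local Open Scope ring_scope.
Variable R : comNzRingType.

(* [a : dirichlet R] stands for the formal series sum_(n >= 1) a(n) n^(-s). The
   product collects the terms a(m) m^(-s) b(n) n^(-s) with m n = k. *)
Definition dirichlet := posnat -> R.
HB.instance Definition _ := GRing.Lmodule.copy dirichlet (posnat -> R^o).

Implicit Types (f g h : dirichlet) (k : posnat).

Definition dirichlet_mul f g : dirichlet :=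
  fun k => \sum_(p \in [set p : posnat * posnat | (p.1 * p.2)%g = k])
             f p.1 * g p.2.

Definition dirichlet_one : dirichlet := fun k => (k == 1%g)%:R.

Lemma dirichlet_mulA : associative dirichlet_mul.
Proof.
by move=> f g k; apply: convA; exact: posnat_finite_fact.
Qed.

Lemma dirichlet_mul1f : left_id dirichlet_one dirichlet_mul.
Proof.
by move=> f; apply: conv1f; exact: posnat_finite_fact.
Qed.

Lemma dirichlet_mulf1 : right_id dirichlet_one dirichlet_mul.
Proof.
by move=> f; apply: convf1; exact: posnat_finite_fact.
Qed.

Lemma dirichlet_mulDl : left_distributive dirichlet_mul +%R.
Proof.
move=> f g h; apply/funext => k.
by apply: convDl; exact: posnat_finite_fact.
Qed.

Lemma dirichlet_mulDr : right_distributive dirichlet_mul +%R.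
Proof.
move=> f g h; apply/funext => k.
by apply: convDr; exact: posnat_finite_fact.
Qed.

Lemma dirichlet_one_neq0 : dirichlet_one != 0.
Proof.
apply/eqP => /(congr1 (fun f : dirichlet => f 1%g)) /eqP.
by rewrite /dirichlet_one eqxx oner_eq0.
Qed.

HB.instance Definition _ := GRing.Zmodule_isNzRing.Build dirichlet
  dirichlet_mulA dirichlet_mul1f dirichlet_mulf1
  dirichlet_mulDl dirichlet_mulDr dirichlet_one_neq0.

Lemma dirichlet_scaleAl (c : R) f g : c *: (f * g) = (c *: f) * g.
Proof.
apply/funext => k.
by apply/esym/convZl; exact: posnat_finite_fact.
Qed.

HB.instance Definition _ :=
  GRing.Lmodule_isLalgebra.Build R dirichlet dirichlet_scaleAl.

Lemma dirichlet_scaleAr (c : R) f g : c *: (f * g) = f * (c *: g).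
Proof.
apply/funext => k.
by apply/esym/convZr; exact: posnat_finite_fact.
Qed.

HB.instance Definition _ :=
  GRing.Lalgebra_isAlgebra.Build R dirichlet dirichlet_scaleAr.

End Dirichlet.

(* Main.v *)
Require Import Defs.
From HB Require Import structures.
From mathcomp Require Import all_boot all_order all_algebra.
From mathcomp Require Import all_classical reals.

(* In a disjoint union of cycles each vertex is the source of a single arc, so a
   trace is determined by the number of letters leaving each vertex, and being a
   hike means that this number is constant along each cycle. A hike is thus a
   finitely supported family of exponents indexed by the cycles. Sending the
   n-th cycle to the n-th prime turns it into a prime factorization, so that
   hikes and positive integers are isomorphic monoids. *)

Set Implicit Arguments.
Unset Strict Implicit.
Unset Printing Implicit Defensive.

(** A bijective morphism carries the factorizations of [n] one-to-one onto those of [psi n], so both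
    sums are the same up to reindexing. *)
Lemma conv_comp (R : comNzRingType) (M N : monoidType) (psi : N -> M) :
  bijective psi -> {morph psi : m n / (m * n)%g} ->
  forall (f g : M -> R) n, conv (f \o psi) (g \o psi) n = conv f g (psi n).
Proof.
move=> [phi psiK phiK] psiM f g n; apply/esym.
rewrite /conv (reindex_fsbig (fun p : N * N => (psi p.1, psi p.2))
  [set p : N * N | (p.1 * p.2)%g = n]) //.
split=> [[a b] /= <-|[a b] [c d] _ _ [/(can_inj psiK)-> /(can_inj psiK)->]|] //.
move=> [a b] /= abn; exists (phi a, phi b); last by rewrite /= !phiK.
by apply: (can_inj psiK); rewrite /= psiM !phiK.
Qed.

(** * Enumeration of the primes *)

Lemma infinite_prime : infinite_set [set q | prime q]%classic.
Proof.
move=> /finite_seqP[s sE]; have [q + pq] := prime_above (\max_(x <- s) x).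
have qs : q \in s by have : [set q | prime q]%classic q by []; rewrite sE.
by rewrite ltnNge leq_bigmax_seq.
Qed.

Lemma prime_enum : exists p : nat -> nat,
  [/\ forall n, prime (p n), injective p & forall q, prime q -> exists n, p n = q].
Proof.
have : ([set: nat] #= [set q | prime q]%classic)%card.
  by rewrite card_eq_le card_leT andbT; exact/infiniteP/infinite_prime.
move=> /card_set_bijP[p [p_prime p_inj p_surj]]; exists p; split.
- by move=> n; exact: (p_prime n I).
- by move=> m n; apply: p_inj; rewrite inE.
- by move=> q /p_surj[n _ <-]; exists n.
Qed.

(** * The cyclic successor map *)

Section NextCycle.
Variables (T : eqType) (s : seq T).
Hypothesis s_uniq : uniq s.

(** Having equal images under [f] is a transitive relation; once it links consecutive elements of a
    cycle, it links all pairs. *)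
Lemma next_invariant_const (T' : eqType) (f : T -> T') :
  {in s, forall x, f (next s x) = f x} -> {in s &, forall x y, f x = f y}.
Proof.
move=> f_next x y xs ys.
have : cycle (fun x y => f x == f y) s.
  by apply: cycle_from_next => // z zs; rewrite f_next.
rewrite cycle_all2rel; last by move=> z t u /eqP-> /eqP->.
by move=> /allrelP/(_ _ _ xs ys)/eqP.
Qed.

Lemma perm_map_next : perm_eq (map (next s) s) s.
Proof.
apply: uniq_perm => //.
  by rewrite (map_inj_uniq (can_inj (prev_next s_uniq))).
move=> y; apply/mapP/idP=> [[x xs ->]|ys]; first by rewrite mem_next.
by exists (prev s y); rewrite ?mem_prev ?next_prev.
Qed.

End NextCycle.

(** * Words and arcs in a disjoint union of cycles *)

Section CycleUnion.
Variables (G : digraph) (C : nat -> seq (vertex G)) (idx : vertex G -> nat).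
Hypothesis C_neq0 : forall n, C n != [::].
Hypothesis C_uniq : forall n, uniq (C n).
Hypothesis C_disj : forall m n x, x \in C m -> x \in C n -> m = n.
Hypothesis mem_idx : forall x, x \in C (idx x).
Hypothesis arcE : forall x y, Defs.arc x y <-> exists2 n, x \in C n & y = next (C n) x.

Implicit Types (x y : vertex G) (a b : letter G) (u v w : word G).

Definition outdeg x w : nat := count (fun a => source a == x) w.

Lemma idx_mem n x : x \in C n -> idx x = n.
Proof. exact/C_disj/mem_idx. Qed.

Lemma target_next a : target a = next (C (idx (source a))) (source a).
Proof. by have [n /idx_mem-> ->] := (arcE (source a) (target a)).1 (valP a). Qed.

Lemma source_inj : injective (@source G).
Proof.
move=> a b ab; apply: val_inj; apply: injective_projections => //.
by rewrite -!/(target _) !target_next ab.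
Qed.

Lemma source_surj x : exists a, source a = x.
Proof.
have xy : Defs.arc x (next (C (idx x)) x) by apply/arcE; exists (idx x).
by exists (exist _ (x, next (C (idx x)) x) xy).
Qed.

(** An arc stays in the cycle of its source, by disjointness, and [next] is injective there: the
    only arc entering the successor of [x] is the one leaving [x]. *)
Lemma target_eq_next n x a :
  x \in C n -> (target a == next (C n) x) = (source a == x).
Proof.
move=> xn; rewrite target_next; apply/eqP/eqP=> [e|->]; last by rewrite (idx_mem xn).
have /idx_mem an : source a \in C n.
  have := mem_idx (source a); rewrite -mem_next e => h.
  by rewrite -(C_disj h (_ : _ \in C n)) ?mem_next // mem_idx.
by move: e; rewrite an => /(can_inj (prev_next (C_uniq n))).
Qed.

(** Balance at the successor of [x] equates its out-degree with its in-degree, which is the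
    out-degree of [x]. *)
Lemma outdeg_const w n :
  balanced w -> {in C n &, forall x y, outdeg x w = outdeg y w}.
Proof.
move=> bw; apply: next_invariant_const => // x xn; rewrite /outdeg bw.
by apply: eq_count => a; rewrite target_eq_next.
Qed.

(** Since a single arc [a] leaves [x], the projection at [x] is a power of [a], known from its
    length. *)
Lemma from_outdeg x u v : outdeg x u = outdeg x v -> from x u = from x v.
Proof.
have [a <-] := source_surj x.
have fromE w : from (source a) w = nseq (outdeg (source a) w) a.
  rewrite /outdeg -size_filter; apply/all_pred1P/allP => b.
  by rewrite mem_filter => /andP[/eqP/source_inj-> _] /=.
by rewrite !fromE => ->.
Qed.

(** * Encoding hikes by prime factorizations *)

Variable p : nat -> nat.
Hypothesis p_prime : forall n, prime (p n).
Hypothesis p_inj : injective p.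
Hypothesis p_surj : forall q, prime q -> exists n, p n = q.

(* Only the letter leaving the first vertex of a cycle has a nontrivial weight,
   so that going once around the n-th cycle contributes [p n]. *)
Definition is_root x : bool := x == head x (C (idx x)).

Definition weight a : nat := if is_root (source a) then p (idx (source a)) else 1.

Definition wordval w : nat := \prod_(a <- w) weight a.

Lemma wordval_gt0 w : 0 < wordval w.
Proof.
by rewrite prodn_gt0 // => a; rewrite /weight; case: ifP => // _; rewrite prime_gt0.
Qed.

Lemma wordval_cat u v : wordval (u ++ v) = wordval u * wordval v.
Proof. exact: big_cat. Qed.

Lemma wordval_cong u v : trace_cong u v -> wordval u = wordval v.
Proof. by move=> /trace_cong_perm uv; exact: perm_big. Qed.

Lemma head_mem n x : head x (C n) \in C n.
Proof. by have := C_neq0 n; case: (C n) => // y s _; rewrite mem_head. Qed.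

Lemma head_default n x y : head x (C n) = head y (C n).
Proof. by have := C_neq0 n; case: (C n). Qed.

(** A letter has weight [p n] exactly when it leaves the head of [C n]; any other weight is 1 or a
    different prime. The default [x] of [head] is never reached, as [C n] is nonempty. *)
Lemma logn_wordval n x w :
  logn (p n) (wordval w) = outdeg (head x (C n)) w.
Proof.
elim: w => [|a w IHw]; first by rewrite /wordval big_nil logn1.
rewrite /wordval big_cons lognM ?wordval_gt0 //; last first.
  by rewrite /weight; case: ifP => // _; rewrite prime_gt0.
rewrite -/(wordval w) IHw; congr (_ + _); rewrite /weight /is_root.
have [an|an] := eqVneq (idx (source a)) n; last first.
  (* Off the [n]-th cycle, the source cannot be the head of [C n]. *)
  rewrite (_ : _ == head x _ = false); last first.
    by apply: contra_neqF an => /eqP->; rewrite (idx_mem (head_mem n x)).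
  case: ifP => _; last by rewrite logn1.
  by rewrite logn_prime // (inj_eq p_inj) eq_sym (negbTE an).
rewrite an (head_default _ x (source a)).
by case: ifP; rewrite ?logn1 // logn_prime // eqxx.
Qed.

(** Valuations at the primes [p n] give the out-degrees at the roots, balance spreads them along the
    cycles, and out-degrees determine every projection of the trace. *)
Lemma wordval_inj u v : balanced u -> balanced v ->
  wordval u = wordval v -> trace_cong u v.
Proof.
move=> bu bv uv; apply/trace_congP => x; apply: from_outdeg.
have hx := head_mem (idx x) x.
rewrite (outdeg_const bu (mem_idx x) hx) (outdeg_const bv (mem_idx x) hx).
by rewrite -!logn_wordval uv.
Qed.

(** The witness goes once around [C n]. *)
Lemma cycle_word n : exists2 w, balanced w & wordval w = p n.
Proof.
have /choice[l lE] := source_surj; exists (map l (C n)).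
  move=> x; rewrite !count_map.
  rewrite (@eq_count _ _ (pred1 x)) => [|y]; last by rewrite /= lE.
  (* The targets are the successors of the sources, and [next] permutes [C n]. *)
  rewrite -(permP (perm_map_next (C_uniq n))) count_map.
  by apply: eq_in_count => y /idx_mem yn; rewrite /= target_next lE yn.
rewrite /wordval big_map; have := C_uniq n; have := @idx_mem n; have := C_neq0 n.
case E: (C n) => [//|x s] _ idxs /andP[xs _].
(* The head gives the factor [p n]; the other vertices differ from it by uniqueness and give 1. *)
rewrite big_cons /weight lE /is_root idxs ?mem_head // E eqxx big1_seq ?muln1 //.
move=> y /= ys; rewrite lE idxs ?inE ?ys ?orbT // E /=.
by case: eqP => // yx; rewrite -yx ys in xs.
Qed.

(** Strong induction: the least prime factor is realized by one turn around its cycle, the quotient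
    by the induction hypothesis. *)
Lemma wordval_surj n : 0 < n -> exists2 w, balanced w & wordval w = n.
Proof.
elim/ltn_ind: n => n IHn n_gt0; have [n_gt1|] := ltnP 1 n; last first.
  by case: n {IHn} n_gt0 => [|[]] // _ _; exists [::]; rewrite /wordval ?big_nil.
have [k pk] := p_surj (pdiv_prime n_gt1); have [u bu uE] := cycle_word k.
have [||v bv vE] := IHn (n %/ pdiv n).
- by rewrite ltn_Pdiv // prime_gt1 // pdiv_prime.
- by rewrite divn_gt0 ?pdiv_gt0 // pdiv_leq.
exists (u ++ v); first by move=> x; rewrite !count_cat bu bv.
by rewrite wordval_cat uE vE pk mulnC divnK // pdiv_dvd.
Qed.

(** By [wordval_cong] the value does not depend on the representative. *)
Definition hikeval (h : hike G) : posnat := PosNat (wordval_gt0 (repr (val h))).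

Lemma hikevalM : {morph hikeval : d h / (d * h)%g}.
Proof.
move=> d h; apply: val_inj => /=; rewrite -wordval_cat; apply: wordval_cong.
apply/trace_ofP; rewrite trace_of_repr -trace_ofM !trace_of_repr.
exact: hike_valM.
Qed.

Lemma hike_balanced (h : hike G) : balanced (repr (val h)).
Proof. by apply/is_hike_trace_of; rewrite trace_of_repr; exact: valP. Qed.

Lemma hikeval_bij : bijective hikeval.
Proof.
rewrite -setTT_bijective; split=> // [d h _ _ /(congr1 val) /= dh|[n n_gt0] _].
  apply: val_inj; rewrite -(trace_of_repr (val d)) -(trace_of_repr (val h)).
  by apply/trace_ofP/wordval_inj => //; exact: hike_balanced.
have [w bw wn] := wordval_surj n_gt0.
have hw : trace_of w \in @is_hike G by apply/is_hike_trace_of.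
exists (Hike hw) => //; apply: val_inj; rewrite /= -wn; apply: wordval_cong.
by apply/trace_ofP; rewrite trace_of_repr.
Qed.

End CycleUnion.

Lemma hike_posnat_iso (G : digraph) : countable_union_of_cycles G ->
  exists2 phi : hike G -> posnat,
    bijective phi & {morph phi : d h / (d * h)%g}.
Proof.
move=> [C [C_nu C_disj /choice[idx mem_idx] arcE]].
have [p [p_prime p_inj p_surj]] := prime_enum.
exists (hikeval C idx p_prime); last exact: hikevalM.
by apply: hikeval_bij => // n; have [] := C_nu n.
Qed.

(** * Transfer to the orders and to the algebras *)

Lemma posnat_dvdP (m n : posnat) : reflect (exists k, n = (m * k)%g) (m <= n)%O.
Proof.
apply: (iffP idP) => [/dvdnP[k nk]|[k ->]]; last exact: dvdn_mulr.
have k_gt0 : 0 < k by have := posnat_gt0 n; rewrite nk muln_gt0 => /andP[].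
by exists (PosNat k_gt0); apply: val_inj; rewrite /= nk mulnC.
Qed.

(** Both orders are left divisibility in a monoid, and cofactors can be moved along [phi] and its
    inverse. *)
Lemma hike_posnat_mono (G : digraph) (phi : hike G -> posnat) :
  bijective phi -> {morph phi : d h / (d * h)%g} -> {mono phi : d h / (d <= h)%O}.
Proof.
move=> [psi phiK psiK] phiM d h; apply/posnat_dvdP/asboolP => -[k hk].
  by exists (psi k); apply: (can_inj phiK); rewrite phiM psiK.
by exists (phi k); rewrite hk phiM.
Qed.

Section Transport.
Variables (R : comNzRingType) (G : digraph) (psi : posnat -> hike G).
Hypotheses (psi_bij : bijective psi) (psiM : {morph psi : m n / (m * n)%g}).

Definition transport (f : incidence R G) : dirichlet R := f \o psi.

Lemma transport_linear : linear transport.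
Proof. by []. Qed.

Lemma transport_monoid : GRing.monoid_morphism transport.
Proof.
have [phi psiK phiK] := psi_bij; split=> [|f g]; apply/funext => n.
  rewrite /transport /= /GRing.one /= /incidence_one /dirichlet_one.
  rewrite -(can_eq psiK); congr (_ == _)%:R%R.
  (* [psi] preserves the unit: cancel [psi 1] in [psi 1 * 1 = psi 1 * psi 1]. *)
  by apply: (@hike_mulgI _ (psi 1%g)); rewrite -psiM !mulg1.
rewrite /transport /= {1}/GRing.mul /= incidence_mulE.
by rewrite -(conv_comp psi_bij psiM).
Qed.

HB.instance Definition _ :=
  GRing.isLinear.Build R (incidence R G) (dirichlet R) _ transport transport_linear.
HB.instance Definition _ :=
  GRing.isMonoidMorphism.Build (incidence R G) (dirichlet R) transport
    transport_monoid.

Lemma transport_iso :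
  exists Phi : {lrmorphism incidence R G -> dirichlet R}, bijective Phi.
Proof.
exists transport; have [phi psiK phiK] := psi_bij.
exists (fun f : dirichlet R => f \o phi) => f; apply/funext => x.
  exact: congr1 (phiK x).
exact: congr1 (psiK x).
Qed.

End Transport.

Theorem theorem3p11 (R : realType) (G : digraph)
    (HG : countable_union_of_cycles G) :
  (exists phi : hike G -> posnat,
      bijective phi /\ {mono phi : d h / (d <= h)%O})
  /\ (exists Phi : {lrmorphism incidence R G -> dirichlet R}, bijective Phi).
Proof.
have [phi phi_bij phiM] := hike_posnat_iso HG; split.
  by exists phi; split=> //; exact: hike_posnat_mono.
have [psi phiK psiK] := phi_bij; apply: (@transport_iso R G psi).
  by exists phi.
by move=> m n; apply: (can_inj phiK); rewrite phiM !psiK.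
Qed.
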